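(* Let $G=(V,E)$ be an undirected graph with nonnegative edge costs $c$, and let $R\subseteq V$ be the set of terminals. Let $\mathrm{OPT}$ denote the minimum cost of a Steiner tree, and let $\mathrm{LP}^*$ denote the optimal value of the hypergraphic linear program \[ \min \sum_K C_K x_K \quad\text{s.t.}\quad \sum_{K:\,K\cap S\neq\varnothing} x_K(|K\cap S|-1)\le |S|-1\ \ \forall\, \varnothing\neq S\subseteq R,\qquad \sum_K x_K(|K|-1)=|R|-1,\qquad x_K\ge 0\ \ \forall K. \] Then $\mathrm{OPT}\le \left(1+\tfrac{\ln 3}{2}\right)\mathrm{LP}^*$. That is, the integrality gap of this relaxation (the supremum over all instances of $\mathrm{OPT}/\mathrm{LP}^*$) is at most $1+\frac{\ln 3}{2}\approx 1.55$.
   Context: A Steiner tree is a tree in $G$ containing all vertices of $R$ (plus possibly some vertices of $V\setminus R$, called Steiner vertices). For a set $K\subseteq R$ of terminals with $|K|\ge 2$, a full component on $K$ is a tree in $G$ whose leaf set is exactly $K$ and whose internal vertices are all Steiner vertices. $C_K$ is the minimum cost of a full component on $K$; the variables $x_K$ range over those $K\subseteq R$, $|K|\ge 2$, for which a full component on $K$ exists. *)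

(* Defs.v *)
From mathcomp Require Import all_boot.
From Stdlib Require Import Reals.
Set Implicit Arguments. Unset Strict Implicit. Unset Printing Implicit Defensive.

Section SteinerDefs.
Variable V : finType.
(* A simple undirected graph: E is a set of 2-element vertex sets (edges). *)
Variable E : {set {set V}}.
(* Terminal set R (called T here to avoid a clash with the reals R). *)
Variable T : {set V}.
Variable c : {set V} -> R.

Definition is_tree (W : {set V}) (F : {set {set V}}) : bool :=
  [&& F \subset E,
      [forall e in F, e \subset W],
      [forall x in W, forall y in W, connect (fun u v => [set u; v] \in F) x y]
    & (#|F|.+1 == #|W|)%N].

Definition tree_cost (F : {set {set V}}) : R := \big[Rplus/0%R]_(e in F) c e.

Definition is_steiner_tree (W : {set V}) (F : {set {set V}}) : bool :=
  is_tree W F && (T \subset W).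

Definition deg (F : {set {set V}}) (v : V) : nat := #|[set e in F | v \in e]|.

Definition leaves (W : {set V}) (F : {set {set V}}) : {set V} :=
  [set v in W | deg F v == 1%N].

Definition is_full_component (K W : {set V}) (F : {set {set V}}) : bool :=
  [&& is_tree W F, leaves W F == K & [disjoint (W :\: K) & T]].

Definition is_hyperedge (K : {set V}) : bool :=
  [&& K \subset T, (1 < #|K|)%N &
      [exists W : {set V}, exists F : {set {set V}}, is_full_component K W F]].

Definition steiner_cost_val (v : R) : Prop :=
  exists W F, is_steiner_tree W F /\ v = tree_cost F.

Definition full_cost_val (K : {set V}) (v : R) : Prop :=
  exists W F, is_full_component K W F /\ v = tree_cost F.

Definition lpsum (f : {set V} -> R) : R :=
  \big[Rplus/0%R]_(K : {set V} | is_hyperedge K) f K.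

Definition lp_feasible (x : {set V} -> R) : Prop :=
  (forall K, is_hyperedge K -> (0 <= x K)%R) /\
  (forall S : {set V}, S \subset T -> S != set0 ->
     (\big[Rplus/0%R]_(K : {set V} | is_hyperedge K && (K :&: S != set0))
         (x K * (INR #|K :&: S| - 1)) <= INR #|S| - 1)%R) /\
  (lpsum (fun K => x K * (INR #|K| - 1)) = INR #|T| - 1)%R.

Definition lp_val (C : {set V} -> R) (v : R) : Prop :=
  exists x, lp_feasible x /\ v = lpsum (fun K => C K * x K)%R.
End SteinerDefs.

Definition IsMin (P : R -> Prop) (v : R) : Prop :=
  P v /\ forall w, P w -> (v <= w)%R.

(* Main.v *)
(* Randomized loss-contracting (Chakrabarty, Koenemann, Pritchard), with the sampling
   replaced by averaging.  Keep a multigraph on the terminals, connecting all of them,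
   whose edges stand for sets of graph edges, together with a set of bought loss edges.
   For a tree of cost C_K on K one can buy a loss of cost l_K <= C_K / 2 so that the
   remaining edges, of cost C_K - l_K, become edges on K connecting K.  By the partition
   inequalities, inserting K with weight x_K lets one delete, in total, at least the
   whole cost of the current terminal tree.  So inserting K with probability p x_K
   shrinks the expected cost w of the terminal tree to (1 - p) w + p (LP - l), while the
   loss grows by p l, where l = sum_K x_K l_K.  Starting from w <= 2 LP and making n
   steps with n p = ln 3, the cost is at most
     2 LP / 3 + 2 (LP - l) / 3 + l ln 3 <= (1 + ln 3 / 2) LP,   as l <= LP / 2.
   The start w <= 2 LP comes from the same averaging, with the doubled trees on the
   sets K inserted instead and no loss. *)
Require Import Defs.
From mathcomp Require Import all_boot all_order all_algebra Rstruct.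
From mathcomp Require zify lra ring.
Set Implicit Arguments. Unset Strict Implicit. Unset Printing Implicit Defensive.
Import Order.TTheory GRing.Theory Num.Theory.
Local Open Scope ring_scope.

(** * Minimum terminal spanning trees before and after contracting a hyperedge *)

Section Bridge.
Import zify.zify algebra_tactics.lra algebra_tactics.ring.
Variables (A : realFieldType) (V : finType) (I : eqType).
Variables (src tgt : I -> V) (wt : I -> A).
Hypothesis wt_ge0 : forall i, 0 <= wt i.

(** Edges are indices with ends [src] and [tgt], so parallel edges of different weight may occur. *)
Definition link (L : seq I) : rel V := fun u v =>
  has (fun i => ((src i == u) && (tgt i == v)) || ((src i == v) && (tgt i == u))) L.

Definition spans (L : seq I) (S : {set V}) :=
  {in S &, forall x y, connect (link L) x y}.

Definition weight (L : seq I) : A := \sum_(i <- L) wt i.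

Definition merge (f : V -> V) (u v : V) : V -> V :=
  fun x => if f x == f v then f u else f x.

(* [f] labels the components built so far, before [K] is contracted: an edge between two
   components that both meet [K] merges them but is not kept. *)
Fixpoint kruskal (K : {set V}) (f : V -> V) (L : seq I) : seq I :=
  if L is i :: L' then
    if f (src i) == f (tgt i) then kruskal K f L' else
    let r := kruskal K (merge f (src i) (tgt i)) L' in
    if (f (src i) \in f @: K) && (f (tgt i) \in f @: K) then r else i :: r
  else [::].

Lemma link_sym (L : seq I) : connect_sym (link L).
Proof.
apply: sym_connect_sym => u v; apply: eq_has => i /=; exact: orbC.
Qed.

Lemma link_in (L : seq I) (i : I) : i \in L -> connect (link L) (src i) (tgt i).
Proof. by move=> iL; apply/connect1/hasP; exists i; rewrite // !eqxx. Qed.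

Lemma link_min (L : seq I) (e : rel V) :
    reflexive e -> symmetric e -> transitive e ->
    {in L, forall i, e (src i) (tgt i)} ->
  forall x y, connect (link L) x y -> e x y.
Proof.
move=> er es et eL x y /connectP[p].
elim: p x => [|z p IH] x /=; first by move=> _ ->; exact: er.
case/andP=> /hasP[i iL /orP[]/andP[/eqP xi /eqP zi]] pp yE;
  apply: (et _ _ _ _ (IH z pp yE)); rewrite -xi -zi ?eL //.
by rewrite es eL.
Qed.

Lemma spans_link (L1 L2 : seq I) (S : {set V}) :
    {in L1, forall i, connect (link L2) (src i) (tgt i)} ->
  spans L1 S -> spans L2 S.
Proof.
move=> L12 s1 x y xS yS; apply: (link_min _ _ _ L12 (s1 x y xS yS)).
- exact: connect0.
- exact: link_sym.
- exact: connect_trans.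
Qed.

Lemma kruskal_sub (K : {set V}) (f : V -> V) (L : seq I) :
  {subset kruskal K f L <= L}.
Proof.
elim: L f => [|i L IH] f j //=; rewrite in_cons.
case: ifP => _; first by move/IH->; rewrite orbT.
case: ifP => _; first by move/IH->; rewrite orbT.
by rewrite in_cons => /orP[->//|/IH->]; rewrite orbT.
Qed.

Lemma merge_eq (f : V -> V) (e : rel V) (u v : V) :
    reflexive e -> symmetric e -> transitive e ->
    (forall x y, f x = f y -> e x y) -> e u v ->
  forall x y, merge f u v x = merge f u v y -> e x y.
Proof.
move=> er es et fe euv x y; rewrite /merge.
have ev z : f z = f v -> e z u by move=> /fe zv; apply: (et v) => //; rewrite es.
case: eqP => [/ev xu|_]; case: eqP => [/ev yu|_] h.
- by apply: (et u) => //; rewrite es.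
- by apply: (et u) => //; exact: fe.
- by apply: (et u); [exact: fe | rewrite es].
- exact: fe.
Qed.

(** A dropped edge either lies inside one class of [f] or joins two classes that both meet [K]; in
    the second case [e] relates its ends through [K]. With [e] the connectivity by the kept edges
    and any edges connecting [K], nothing is lost by dropping. *)
Lemma kruskal_equiv (K : {set V}) (e : rel V) (f : V -> V) (L : seq I) :
    reflexive e -> symmetric e -> transitive e ->
    {in K &, forall x y, e x y} -> (forall x y, f x = f y -> e x y) ->
    {in kruskal K f L, forall i, e (src i) (tgt i)} ->
  {in L, forall i, e (src i) (tgt i)}.
Proof.
move=> er es et eK; elim: L f => [|i L IH] f fe kL //= j.
move: kL => /=; case: eqP => [fuv|_] kL.
  by rewrite inE => /predU1P[->|/(IH _ fe kL)//]; exact: fe.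
have euv : e (src i) (tgt i).
  move: kL; case: ifP => [/andP[/imsetP[a aK ua] /imsetP[b bK vb]] _|_ kL].
    apply: (et a); first exact: fe.
    by apply: (et b); [exact: eK | rewrite es; exact: fe].
  by apply: kL; rewrite mem_head.
rewrite inE => /predU1P[->//|]; apply: IH => [|k kk].
  exact: (merge_eq er es et fe euv).
by apply: kL; case: ifP => // _; rewrite inE kk orbT.
Qed.

Lemma card_merge (f : V -> V) (u v : V) (S : {set V}) : f u != f v ->
  #|f @: S| = (#|merge f u v @: S| + ((f u \in f @: S) && (f v \in f @: S)))%N.
Proof.
move=> uv; set h := fun y => if y == f v then f u else y.
have -> : merge f u v @: S = h @: (f @: S) by rewrite -imset_comp; apply: eq_imset.
move: (f @: S) => Y; have [vY|vY] := boolP (f v \in Y); last first.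
  rewrite andbF addn0; suff -> : h @: Y = Y by [].
  rewrite -[RHS]imset_id; apply: eq_in_imset => y yY; rewrite /h.
  by case: eqP => // yv; rewrite -yv yY in vY.
have -> : h @: Y = f u |: (Y :\ f v).
  apply/setP => y; rewrite !inE; apply/imsetP/idP => [[z zY ->]|].
    by rewrite /h; case: (z =P f v) => [_|/eqP zv]; rewrite ?eqxx // zv zY orbT.
  case/predU1P=> [->|/andP[yv yY]]; first by exists (f v); rewrite // /h eqxx.
  by exists y; rewrite // /h (negPf yv).
rewrite cardsU1 (cardsD1 (f v) Y) vY !inE uv andbT (cardsD1 (f u) (Y :\ _)) !inE uv.
by case: (f u \in Y); lia.
Qed.

Variables (T : {set V}) (H : pred {set V}) (x : {set V} -> A).
Hypothesis T_neq0 : T != set0.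
Hypothesis H_sub : forall K, H K -> K \subset T.
Hypothesis H_neq0 : forall K, H K -> K != set0.
Hypothesis x_sub : forall S : {set V}, S \subset T -> S != set0 ->
  \sum_(K | H K && (K :&: S != set0)) x K * (#|K :&: S|%:R - 1) <= #|S|%:R - 1.
Hypothesis x_eq : \sum_(K | H K) x K * (#|K|%:R - 1) = #|T|%:R - 1.

(** The slack of the partition inequality for the partition of [T] into the fibres of [f]. *)
Definition excess (f : V -> V) : A :=
  \sum_(K | H K) x K * (#|f @: K|%:R - 1) - (#|f @: T|%:R - 1).

(** The fibres that meet [S] cut [S] into [#|f @: S|] parts, each of which contributes its size
    minus one. *)
Lemma card_fibers (f : V -> V) (S : {set V}) : S \subset T ->
  \sum_(y in f @: T | S :&: (T :&: f @^-1: [set y]) != set0)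
     (#|S :&: (T :&: f @^-1: [set y])|%:R - 1) = #|S|%:R - #|f @: S|%:R :> A.
Proof.
move=> ST.
have fE y : S :&: (T :&: f @^-1: [set y]) = [set z in S | f z == y].
  by apply/setP => z; rewrite !inE; case zS: (z \in S) => //=; rewrite (subsetP ST).
rewrite (eq_bigl (fun y => y \in f @: S)); last first.
  move=> y /=; rewrite fE; apply/andP/imsetP => [[_ /set0Pn[z]]|[z zS ->]].
    by rewrite inE => /andP[zS /eqP<-]; exists z.
  split; first by apply/imset_f/(subsetP ST).
  by apply/set0Pn; exists z; rewrite inE zS eqxx.
rewrite big_split /= sumrN sumr_const; congr (_ - _).
rewrite -natr_sum -[in RHS]sum1_card; congr (_%:R); rewrite [RHS](partition_big_imset f) /=.
by apply: eq_bigr => y _; rewrite fE -sum1_card; apply: eq_bigl => z; rewrite inE.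
Qed.

(* Summing the constraints over the fibres of [f] in [T] gives the partition inequality. *)
Lemma excess_ge0 (f : V -> V) : 0 <= excess f.
Proof.
pose S y := T :&: f @^-1: [set y].
have S0 y : y \in f @: T -> S y != set0.
  by case/imsetP=> z zT ->; apply/set0Pn; exists z; rewrite !inE zT eqxx.
have : \sum_(y in f @: T) \sum_(K | H K && (K :&: S y != set0))
      x K * (#|K :&: S y|%:R - 1) <= \sum_(y in f @: T) (#|S y|%:R - 1 : A).
  by apply: ler_sum => y yT; apply: x_sub; [exact: subsetIl | exact: S0].
rewrite (exchange_big_dep H) /=; last by move=> y K _ /andP[].
have -> : \sum_(y in f @: T) (#|S y|%:R - 1 : A) = #|T|%:R - #|f @: T|%:R.
  rewrite -(card_fibers f (subxx T)); apply: eq_big => [y|y _];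
    last by rewrite /S setIA setIid.
  by rewrite setIA setIid; case yT: (_ \in _) => //; rewrite S0.
rewrite (eq_bigr (fun K => x K * (#|K|%:R - 1) - x K * (#|f @: K|%:R - 1))); last first.
  move=> K HK; rewrite -mulr_sumr -mulrBr; congr (_ * _).
  rewrite (eq_bigl (fun y => (y \in f @: T) && (K :&: S y != set0)));
    last by move=> y; rewrite HK.
  by rewrite card_fibers ?H_sub //; ring.
rewrite sumrB x_eq /excess; lra.
Qed.

(** Summation by parts along the edge order. A merging edge adds its weight times the drop of
    [excess] to the right-hand side; since the weights do not decrease and [excess] stays
    nonnegative, the total is at least [theta * excess f]. The condition on [g] says that [L] and
    the classes of [f] together connect [T]. *)
Lemma kruskal_excess (f : V -> V) (L : seq I) (theta : A) :
    sorted (fun i j => wt i <= wt j) L -> {in L, forall i, theta <= wt i} ->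
    {in L, forall i, (src i \in T) && (tgt i \in T)} ->
    (forall g : V -> V, (forall a b, f a = f b -> g a = g b) ->
       {in L, forall i, g (src i) = g (tgt i)} -> {in T &, forall a b, g a = g b}) ->
  theta * excess f <= \sum_(K | H K) x K *
     (weight (kruskal set0 f L) - weight (kruskal K f L)) - weight (kruskal set0 f L).
Proof.
elim: L f theta => [|i L IH] f theta.
  (* No edge is left: taking [g := f] shows that [f] is constant on [T], so the images of nonempty
     subsets are singletons and the excess vanishes. *)
  move=> _ _ _ /(_ f (fun _ _ => id))fT; rewrite /weight big_nil subrr.
  under eq_bigr => K _ do rewrite mulr0.
  have {}fT : {in T &, forall a b, f a = f b} by exact: fT.
  rewrite big1 // /excess.
  have cf (S : {set V}) : S \subset T -> S != set0 -> #|f @: S| = 1%N.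
    move=> ST /set0Pn[z zS]; apply/eqP/cards1P; exists (f z); apply/setP => y.
    rewrite !inE; apply/imsetP/eqP => [[a aS ->]|->]; last by exists z.
    by apply: fT; apply: (subsetP ST).
  rewrite big1 => [|K HK]; last by rewrite (cf K (H_sub HK) (H_neq0 HK)) subrr mulr0.
  by rewrite (cf T) // subrr oppr0 addr0 mulr0.
move=> wL thL TL gL.
have {}wL : sorted (fun i j => wt i <= wt j) L /\ {in L, forall j, wt i <= wt j}.
  move: wL; rewrite /= path_sortedE => [/andP[/allP ? ?]|a b c]; last exact: le_trans.
  by split.
have [uT vT] := andP (TL i (mem_head _ _)).
have {}TL : {in L, forall i, (src i \in T) && (tgt i \in T)}.
  by move=> j jL; apply: TL; rewrite inE jL orbT.
have {}thL : theta <= wt i by apply: thL; rewrite mem_head.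
rewrite /=; case: (f (src i) =P f (tgt i)) => [fuv|/eqP fuv].
  apply: IH => //; [exact: wL.1 | by move=> j /wL.2; apply: le_trans |].
  move=> g fg gL'; apply: gL => // j; rewrite inE => /predU1P[->|/gL'//].
  exact: fg.
set u := src i; set v := tgt i; set f' := merge f u v.
have /(IH f' (wt i) wL.1 wL.2 TL) : forall g : V -> V,
   (forall a b, f' a = f' b -> g a = g b) ->
   {in L, forall j, g (src j) = g (tgt j)} -> {in T &, forall a b, g a = g b}.
  move=> g fg gL'.
  apply: gL => [a b fab|j]; first by apply: fg; rewrite /f' /merge fab.
  rewrite inE => /predU1P[->|/gL'//]; apply: fg.
  by rewrite /f' /merge eqxx -/u -/v; case: eqP.
have W0 : weight (i :: kruskal set0 f' L) = wt i + weight (kruskal set0 f' L).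
  by rewrite /weight big_cons.
rewrite imset0 inE /= W0 => IHi.
have -> : \sum_(K | H K) x K * (wt i + weight (kruskal set0 f' L) -
    weight (if (f u \in f @: K) && (f v \in f @: K) then kruskal K f' L
            else i :: kruskal K f' L)) =
  \sum_(K | H K) x K * (weight (kruskal set0 f' L) - weight (kruskal K f' L)) +
  wt i * \sum_(K | H K) x K * (#|f @: K|%:R - #|f' @: K|%:R).
  rewrite mulr_sumr -big_split; apply: eq_bigr => K HK /=.
  rewrite (card_merge K fuv) -/f' natrD; case: ifP => _ /=.
    by ring.
  by rewrite /weight big_cons /=; ring.
have E : excess f = \sum_(K | H K) x K * (#|f @: K|%:R - #|f' @: K|%:R) - 1 + excess f'.
  rewrite /excess (card_merge T fuv) !imset_f //= -/f'.
  have -> : \sum_(K | H K) x K * (#|f @: K|%:R - #|f' @: K|%:R) =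
    \sum_(K | H K) x K * (#|f @: K|%:R - 1) - \sum_(K | H K) x K * (#|f' @: K|%:R - 1) :> A.
    by rewrite -sumrB; apply: eq_bigr => K _; ring.
  by rewrite natrD; ring.
have := ler_wpM2r (excess_ge0 f) thL; have := congr1 (fun y => wt i * y) E.
have := IHi; lra.
Qed.

Lemma weight_kruskal (K : {set V}) (f : V -> V) (L : seq I) :
  weight (kruskal K f L) <= weight L.
Proof.
rewrite /weight; elim: L f => [|i L IH] f //=; rewrite big_cons.
have le0 g : \sum_(j <- kruskal K g L) wt j <= wt i + \sum_(j <- L) wt j.
  by apply: le_trans (IH g) _; rewrite lerDr.
by do 2?[case: ifP => _ //]; rewrite big_cons lerD2l.
Qed.

(** Kruskal's algorithm on one sorted list supplies everything: [L0] with nothing contracted, [M K]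
    with [K] contracted. The last bound is the partition inequality summed along the run. *)
Lemma bridge (L : seq I) :
    spans L T -> {in L, forall i, (src i \in T) && (tgt i \in T)} ->
  exists (L0 : seq I) (M : {set V} -> seq I),
    [/\ {subset L0 <= L} /\ (forall K, {subset M K <= L}),
        weight L0 <= weight L, spans L0 T,
        forall K B, spans B K -> spans (M K ++ B) T &
        weight L0 <= \sum_(K | H K) x K * (weight L0 - weight (M K))].
Proof.
move=> sL TL; pose leW i j := wt i <= wt j; pose S := sort leW L.
have pS : perm_eq S L by rewrite perm_sort.
have mS : S =i L by exact: perm_mem.
have sS : spans S T.
  by apply: spans_link sL => i iL; apply: link_in; rewrite mS.
have wS : weight S = weight L by apply: perm_big.
have kS K B : spans B K -> spans (kruskal K id S ++ B) T.
  move=> sB; apply: spans_link sS.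
  have catl C D : {subset C <= D} ->
      forall a b : V, connect (link C) a b -> connect (link D) a b.
    move=> CD a b; apply: connect_sub => {}a {}b /hasP[i iC h].
    by apply/connect1/hasP; exists i; rewrite ?CD.
  apply: (@kruskal_equiv K _ id).
  - exact: connect0.
  - exact: link_sym.
  - exact: connect_trans.
  - move=> a b aK bK; apply: catl (sB a b aK bK) => i; rewrite mem_cat => ->.
    exact: orbT.
  - by move=> a b ->; exact: connect0.
  - by move=> i iS; apply: link_in; rewrite mem_cat iS.
exists (kruskal set0 id S), (fun K => kruskal K id S); split.
- by split=> [|K] i /kruskal_sub; rewrite mS.
- by rewrite -wS weight_kruskal.
- by rewrite -[kruskal _ _ _]cats0; apply: kS => a b; rewrite inE.
- exact: kS.
(* The run starts from singletons; as weights are nonnegative, [theta = 0] is a valid lower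
   bound. *)
- rewrite -subr_ge0 -[leLHS](mul0r (excess id)).
  apply: kruskal_excess.
  + by apply: sort_sorted => a b; exact: le_total.
  + by move=> i _; exact: wt_ge0.
  + by move=> i; rewrite mS; exact: TL.
  + move=> g _ gS a b aT bT; apply/eqP.
    apply: (@link_min S (fun a b => g a == g b)) (sS a b aT bT) => [z|y z|y z t|i iS].
    * exact: eqxx.
    * exact: eq_sym.
    * by move=> /eqP-> .
    * by rewrite gS.
Qed.
End Bridge.

(** * Trees in the graph, grown leaf by leaf *)

Section Trees.
Import zify.zify algebra_tactics.lra algebra_tactics.ring.
Variables (A : realFieldType) (V : finType) (E : {set {set V}}).
Variable c : {set V} -> A.
Hypothesis c_ge0 : forall e, 0 <= c e.

Definition cost (P : {set {set V}}) : A := \sum_(e in P) c e.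

Lemma cost0 : cost set0 = 0.
Proof. by rewrite /cost big_set0. Qed.

Lemma cost_ge0 (P : {set {set V}}) : 0 <= cost P.
Proof. exact: sumr_ge0. Qed.

Lemma costU (P Q : {set {set V}}) : cost (P :|: Q) <= cost P + cost Q.
Proof.
rewrite /cost (big_setID P) /= setIUl setIid (setUidPl (subsetIr _ _)) lerD2l.
rewrite setDUl setDv set0U (big_setID P (A := Q)) /= lerDr.
exact: sumr_ge0.
Qed.

Lemma cost_subset (P Q : {set {set V}}) : P \subset Q -> cost P <= cost Q.
Proof.
by move=> PQ; rewrite /cost (big_setID P (A := Q)) /= (setIidPr PQ) lerDl sumr_ge0.
Qed.

Lemma costU1 (e : {set V}) (P : {set {set V}}) : cost (e |: P) <= c e + cost P.
Proof. by apply: le_trans (costU _ _) _; rewrite {1}/cost big_set1. Qed.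

(** Intersecting with [E] spares the edge sets used below a containment condition. *)
Definition adj (P : {set {set V}}) : rel V := fun u v => [set u; v] \in P :&: E.

Lemma adj_sym (P : {set {set V}}) : connect_sym (adj P).
Proof. by apply: sym_connect_sym => u v; rewrite /adj setUC. Qed.

Lemma adj_mono (P Q : {set {set V}}) : P \subset Q ->
  forall u v, connect (adj P) u v -> connect (adj Q) u v.
Proof.
move=> PQ; apply: connect_sub => a b ab; apply: connect1.
exact: (subsetP (setSI E PQ)).
Qed.

(** Trees as an inductive family, so that an induction can cut off the last leaf [v]. *)
Inductive grown (r : V) : {set V} -> {set {set V}} -> Prop :=
| grown1 : grown r [set r] set0
| grownS W F u v : grown r W F -> u \in W -> v \notin W -> [set u; v] \in E ->
    grown r (v |: W) ([set u; v] |: F).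

Lemma grown_root r W F : grown r W F -> r \in W.
Proof. by elim=> [|W' F' u v _ IH *]; rewrite ?set11 // !inE IH orbT. Qed.

Lemma grown_edges r W F : grown r W F ->
  {in F, forall e : {set V}, (e \in E) && (e \subset W)}.
Proof.
elim=> [|W' F' u v _ IH uW vW uvE] e; rewrite !inE // => /predU1P[->|/IH/andP[-> eW]].
  by rewrite uvE; apply/subsetP => z; rewrite !inE => /orP[]/eqP->; rewrite ?uW ?eqxx ?orbT.
exact: subset_trans eW (subsetUr _ _).
Qed.

Lemma grown_fresh r W F u v : grown r W F -> v \notin W -> [set u; v] \notin F.
Proof.
move=> gF vW; apply: contra vW => /(grown_edges gF)/andP[_ /subsetP]; apply.
by rewrite !inE eqxx orbT.
Qed.

Lemma grown_card r W F : grown r W F -> #|F|.+1 = #|W|.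
Proof.
elim=> [|W' F' u v gF IH uW vW uvE]; first by rewrite cards1 cards0.
by rewrite !cardsU1 vW (grown_fresh u gF vW) -IH.
Qed.

Lemma grown_connect r W F : grown r W F -> {in W, forall x, connect (adj F) r x}.
Proof.
elim=> [|W' F' u v gF IH uW vW uvE] x; rewrite !inE; first by move/eqP->; exact: connect0.
have sF := adj_mono (subsetUr [set [set u; v]] F').
case/predU1P=> [->|/IH/sF//]; apply: connect_trans (sF _ _ (IH u uW)) (connect1 _).
by rewrite /adj !inE eqxx.
Qed.

Lemma grown_is_tree r W F : grown r W F -> is_tree E W F.
Proof.
move=> gF; have eF := grown_edges gF; apply/and4P; split.
- by apply/subsetP => e /eF/andP[].
- by apply/forall_inP => e /eF/andP[].
- have cF x : x \in W -> connect (fun u v => [set u; v] \in F) r x.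
    by move/(grown_connect gF); apply: connect_sub => a b /setIP[ab _]; exact: connect1.
  have sF : connect_sym (fun u v => [set u; v] \in F).
    by apply: sym_connect_sym => a b; rewrite setUC.
  apply/forall_inP => x xW; apply/forall_inP => y yW.
  by apply: connect_trans (cF y yW); rewrite sF cF.
- by rewrite (grown_card gF).
Qed.

Lemma connect_exit (e : rel V) (W : {set V}) (x y : V) :
  connect e x y -> x \in W -> y \notin W -> exists u v, [/\ u \in W, v \notin W & e u v].
Proof.
case/connectP=> p; elim: p x => [|z p IH] x /=; first by move=> _ -> ->.
case/andP=> xz pz yE xW yW; have [zW|zW] := boolP (z \in W).
  exact: IH pz yE zW yW.
by exists x, z.
Qed.

(** While a vertex of [T] is missing, a path to it leaves [W] by some edge, which attaches a new
    leaf; the number of vertices outside [W] decreases. *)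
Lemma grow (r : V) (F : {set {set V}}) (T : {set V}) :
    {in T, forall x, connect (adj F) r x} ->
  exists W F', [/\ grown r W F', F' \subset F & T \subset W].
Proof.
move=> FT; have: grown r [set r] set0 by exact: grown1.
move: [set r] set0 (sub0set F) => W F'.
have [n] := ubnP #|~: W|; elim: n W F' => // n IH W F' nW F'F gF.
have [TW|/subsetPn[x xT xW]] := boolP (T \subset W); first by exists W, F'.
have [u [v [uW vW /setIP[uvF uvE]]]] := connect_exit (FT x xT) (grown_root gF) xW.
apply: (IH (v |: W) ([set u; v] |: F')).
- have := cardsC (v |: W); have := cardsC W; rewrite cardsU1 vW; lia.
- by rewrite subUset sub1set uvF.
- exact: grownS.
Qed.

(** Growing inside [F] until [W] is covered reaches exactly [W]; both edge sets then have [#|W| - 1]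
    elements, so nothing of [F] is left out. *)
Lemma tree_grown (r : V) (W : {set V}) (F : {set {set V}}) :
  is_tree E W F -> r \in W -> grown r W F.
Proof.
case/and4P=> FE /forall_inP FW /forall_inP cF /eqP cardF rW.
have adjF : {in W, forall x, connect (adj F) r x}.
  move=> x xW; move/forall_inP: (cF r rW) => /(_ x xW).
  by rewrite /adj (setIidPl FE).
have [W' [F' [gF F'F WW']]] := grow adjF.
have W'W : W' \subset W.
  elim: gF F'F {WW'} => [|W1 F1 u v g1 IH uW vW uvE]; first by rewrite sub1set.
  rewrite !subUset !sub1set => /andP[uvF /IH->]; rewrite andbT.
  by apply: (subsetP (FW _ uvF)); rewrite !inE eqxx orbT.
have WE : W' = W by apply/eqP; rewrite eqEsubset W'W.
rewrite WE in gF; suff <- : F' = F by [].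
by apply/eqP; rewrite eqEcard F'F -ltnS (grown_card gF) cardF leqnn.
Qed.

(** * Splitting a tree into loss edges and edges between terminals *)

Definition tedge := (V * V * {set {set V}})%type.
Definition tsrc (i : tedge) := i.1.1.
Definition ttgt (i : tedge) := i.1.2.
Definition tcost (i : tedge) := cost i.2.
Notation tlink := (link tsrc ttgt).
Notation tweight := (weight tcost).

Definition pcost (s : V -> option (V * {set {set V}})) (v : V) : A :=
  if s v is Some (_, Q) then cost Q else 0.

Lemma pcost_upd (s : V -> option (V * {set {set V}})) (W : {set V}) u t : u \in W ->
  \sum_(v in W) pcost (fun x => if x == u then Some t else s x) v =
  \sum_(v in W) pcost s v - pcost s u + cost t.2.
Proof.
move=> uW; rewrite !(big_setD1 u uW) /= {1}/pcost eqxx; case: t => k Q /=.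
rewrite [RHS]addrC addrAC subrr add0r; congr (_ + _); apply: eq_bigr => v.
by rewrite !inE /pcost => /andP[/negPf->].
Qed.

(* [s v] is the pending path from [v] to a terminal in the part of the tree
   already folded into [v]; [Lo] holds the loss edges chosen so far.  When two
   pending paths meet, the cheaper one is put into the loss if [b], and is kept
   pending otherwise (which yields the spanning tree of at most twice the cost). *)
Lemma fold_tree (b : bool) (K : {set V}) r W F : grown r W F ->
  forall (s : V -> option (V * {set {set V}})) (Lo : {set {set V}}),
    (forall v k Q, v \in W -> s v = Some (k, Q) ->
       k \in K /\ connect (adj (Lo :|: Q)) v k) ->
  exists (Lo' : {set {set V}}) (B : seq tedge),
    [/\ {in B, forall i, [/\ tsrc i \in K, ttgt i \in K &
           connect (adj (Lo :|: Lo' :|: i.2)) (tsrc i) (ttgt i)]},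
        forall v v' k k' Q Q', v \in W -> v' \in W ->
          s v = Some (k, Q) -> s v' = Some (k', Q') -> connect (tlink B) k k',
        (~~ b -> Lo' = set0) &
        let X := cost F + \sum_(v in W) pcost s v in
        if b then tweight B + cost Lo' <= X /\ 2 * cost Lo' <= X
        else tweight B <= 2 * X].
Proof.
elim=> [|{}W {}F u v gF IH uW vW uvE] s Lo sP.
  exists set0, [::]; split=> //.
    move=> v v' k k' Q Q' /set1P-> /set1P-> -> [-> _]; exact: connect0.
  have : 0 <= \sum_(v in [set r]) pcost s v.
    by apply: sumr_ge0 => v _; rewrite /pcost; case: (s v) => [[]|] *; rewrite ?cost_ge0.
  by rewrite /weight /cost big_nil big_set0 /=; case: b; try split; lra.
have sPW x k Q : x \in W -> s x = Some (k, Q) -> k \in K /\ connect (adj (Lo :|: Q)) x k.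
  by move=> xW; apply: sP; rewrite inE xW orbT.
have cF : cost ([set u; v] |: F) = c [set u; v] + cost F.
  by rewrite /cost big_setU1 // (grown_fresh u gF).
have sumE : \sum_(x in v |: W) pcost s x = pcost s v + \sum_(x in W) pcost s x.
  by rewrite big_setU1.
(* If nothing is pending at the leaf [v], it is simply cut off. *)
case sv: (s v) => [[k2 Q]|]; last first.
  have [Lo' [B [BK sB bL bB]]] := IH s Lo sPW; exists Lo', B; split=> //.
    move=> x y k k' Q Q' /setU1P[->|xW]; first by rewrite sv.
    by move=> /setU1P[->|yW]; [rewrite sv | exact: sB].
  move: bB; rewrite /= sumE cF (_ : pcost s v = 0); last by rewrite /pcost sv.
  by case: (b) => [[]|]; have := c_ge0 [set u; v]; try split; lra.
have [k2K vk2] : k2 \in K /\ connect (adj (Lo :|: Q)) v k2.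
  by apply: sP sv; rewrite !inE eqxx.
have pv : pcost s v = cost Q by rewrite /pcost sv.
(* The path pending at [v], prolonged by the edge to [u], is passed on to [u]. *)
pose Q2 := [set u; v] |: Q.
have cQ2 : cost Q2 <= c [set u; v] + cost Q by exact: costU1.
have uk2 : connect (adj (Lo :|: Q2)) u k2.
  apply: connect_trans (connect1 _) _; last first.
    by apply: adj_mono vk2; apply: setUS; exact: subsetUr.
  by rewrite /adj !inE eqxx uvE orbT.
have upd (t : V * {set {set V}}) : t.1 \in K ->
    forall Lo1 : {set {set V}}, Lo \subset Lo1 -> connect (adj (Lo1 :|: t.2)) u t.1 ->
    forall x k Q', x \in W -> (if x == u then Some t else s x) = Some (k, Q') ->
    k \in K /\ connect (adj (Lo1 :|: Q')) x k.
  case: t => k Q0 /= kK Lo1 LoS uk x k' Q' xW.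
  case: eqP => [-> [<- <-]|_ /(sPW _ _ _ xW)[k'K xk']] //.
  by split=> //; apply: adj_mono xk'; exact: setSU.
case su: (s u) => [[k1 Q1]|]; last first.
  have [Lo' [B [BK sB bL bB]]] := IH _ Lo (upd (k2, Q2) k2K Lo (subxx _) uk2).
  exists Lo', B; split=> //.
    pose h x := if x == v then u else x.
    have hP x k Q' : x \in v |: W -> s x = Some (k, Q') ->
        exists Q'', (if h x == u then Some (k2, Q2) else s (h x)) = Some (k, Q'').
      rewrite /h; case: (x =P v) => [->|_ _].
        by rewrite sv eqxx => _ [<- _]; exists Q2.
      by case: eqP => [->|_ ->]; [rewrite su | exists Q'].
    have hW x : x \in v |: W -> h x \in W by rewrite /h !inE; case: eqP => [->|].
    move=> x y k k' Q' Q'' xW yW /(hP _ _ _ xW)[? sx] /(hP _ _ _ yW)[? sy].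
    by apply: sB sx sy; apply: hW.
  move: bB; rewrite /= pcost_upd // sumE cF /= pv (_ : pcost s u = 0); last by rewrite /pcost su.
  by case: (b) => [[]|]; have := c_ge0 [set u; v]; try split; lra.
have [k1K uk1] := sPW _ _ _ uW su.
have [a1 [a2 [Qa [Qb [ab uka ukb kab]]]]] : exists a1 a2 Qa Qb,
   [/\ cost Qa <= cost Qb, connect (adj (Lo :|: Qa)) u a1,
       connect (adj (Lo :|: Qb)) u a2 &
       (a1, a2) = (k1, k2) /\ (Qa, Qb) = (Q1, Q2) \/
       (a1, a2) = (k2, k1) /\ (Qa, Qb) = (Q2, Q1)].
  case: (leP (cost Q1) (cost Q2)) => [|/ltW] h.
    by exists k1, k2, Q1, Q2; split=> //; left.
  by exists k2, k1, Q2, Q1; split=> //; right.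
have a1K : a1 \in K by case: kab => [[[-> _] _]|[[-> _] _]].
have a2K : a2 \in K by case: kab => [[[_ ->] _]|[[_ ->] _]].
have cab : cost Qa + cost Qb = cost Q1 + cost Q2.
  by case: kab => [[_ [-> ->]]|[_ [-> ->]]]; rewrite // addrC.
(* [Qa], leading to [a1], is the cheaper path. With [b] it is bought, [a1] stays at [u] with an
   empty path, and the new terminal edge pays only [Qb]; the loss is at most half of the two.
   Without [b] the edge pays both paths and [Qa] stays pending: the budget drops by at least
   [cost Qb], which is at least half of what the edge pays. *)
pose L1 := if b then Qa else set0.
pose Qn := if b then set0 else Qa.
pose P := if b then Qb else Qa :|: Qb.
have uQn : connect (adj (Lo :|: L1 :|: Qn)) u a1.
  by rewrite -setUA /L1 /Qn; case: (b); rewrite ?set0U ?setU0.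
have := IH _ _ (upd (a1, Qn) a1K (Lo :|: L1) (subsetUl _ _) uQn).
case=> [Lo' [B [BK sB bL bB]]].
exists (L1 :|: Lo'), ((a1, a2, P) :: B); split.
- move=> i; rewrite inE => /predU1P[->|/BK]; last by rewrite setUA.
  split=> //=; apply: (@connect_trans _ _ u).
    rewrite adj_sym; apply: adj_mono uka; rewrite /L1 /P; case: (b); apply/subsetP => z;
      rewrite !inE => /orP[]->; by rewrite ?orbT.
  apply: adj_mono ukb; rewrite /L1 /P; case: (b); apply/subsetP => z;
      rewrite !inE => /orP[]->; by rewrite ?orbT.
- have l12 : connect (tlink ((a1, a2, P) :: B)) a1 a2.
    exact: (@link_in _ _ tsrc ttgt _ (a1, a2, P) (mem_head _ _)).
  have lB : {in B, forall i, connect (tlink ((a1, a2, P) :: B)) (tsrc i) (ttgt i)}.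
    by move=> i iB; apply: link_in; rewrite inE iB orbT.
  have {}sB x y k k' Q' Q'' : x \in W -> y \in W ->
      (if x == u then Some (a1, Qn) else s x) = Some (k, Q') ->
      (if y == u then Some (a1, Qn) else s y) = Some (k', Q'') ->
      connect (tlink ((a1, a2, P) :: B)) k k'.
    move=> xW yW sx sy; apply: (link_min _ _ _ lB (sB _ _ _ _ _ _ xW yW sx sy)).
    + exact: connect0.
    + exact: link_sym.
    + exact: connect_trans.
  have l k : k = k1 \/ k = k2 -> connect (tlink ((a1, a2, P) :: B)) k a1.
    by rewrite link_sym; case: kab => [[[<- <-] _]|[[<- <-] _]] [] ->; rewrite ?connect0.
  pose h x := if x == v then u else x.
  have hW x : x \in v |: W -> h x \in W by rewrite /h !inE; case: eqP => [->|].
  have hP x k Q' : x \in v |: W -> s x = Some (k, Q') ->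
      exists k' Q'', connect (tlink ((a1, a2, P) :: B)) k k' /\
        (if h x == u then Some (a1, Qn) else s (h x)) = Some (k', Q'').
    rewrite /h; case: (x =P v) => [->|_ _].
      by rewrite sv eqxx => _ [<- _]; exists a1, Qn; split=> //; apply: l; right.
    case: eqP => [->|_ sx]; last by exists k, Q'; split=> //; exact: connect0.
    by rewrite su => -[<- _]; exists a1, Qn; split=> //; apply: l; left.
  move=> x y k k' Q' Q'' xW yW /(hP _ _ _ xW)[ka [? [kk sx]]] /(hP _ _ _ yW)[kb [? [kk' sy]]].
  apply: connect_trans kk _; rewrite link_sym; apply: connect_trans kk' _.
  by rewrite link_sym; apply: sB sx sy; apply: hW.
- by move=> nb; rewrite (bL nb) /L1 (negPf nb) setU0.
- have cL := costU L1 Lo'; have cP : cost P <= if b then cost Qb else cost Qa + cost Qb.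
    by rewrite /P; case: (b) => //; exact: costU.
  move: bB cL cP; rewrite /= pcost_upd // sumE cF /= pv (_ : pcost s u = cost Q1);
    last by rewrite /pcost su.
  rewrite (_ : tweight (_ :: B) = cost P + tweight B); last by rewrite /weight big_cons.
  rewrite /L1 /Qn; case: (b); rewrite ?cost0.
    by case=> *; split; lra.
  by move=> *; lra.
Qed.

(** Each terminal starts with the empty path to itself, so no pending cost is present at first and
    the fold is charged to [cost F] alone. *)
Lemma tree_terminals (b : bool) (K W : {set V}) (F : {set {set V}}) :
    is_tree E W F -> K \subset W -> K != set0 ->
  exists (Lo : {set {set V}}) (B : seq tedge),
    [/\ {in B, forall i, [/\ tsrc i \in K, ttgt i \in K &
           connect (adj (Lo :|: i.2)) (tsrc i) (ttgt i)]},
        spans tsrc ttgt B K,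
        (~~ b -> Lo = set0) &
        if b then tweight B + cost Lo <= cost F /\ 2 * cost Lo <= cost F
        else tweight B <= 2 * cost F].
Proof.
move=> FW KW /set0Pn[r rK].
have gF := tree_grown FW (subsetP KW _ rK).
have [v k Q _|Lo [B [BK sB bL bB]]] := fold_tree b (K := K) gF
   (s := fun v => if v \in K then Some (v, set0) else None) (Lo := set0).
  by case: ifP => // vK [<- _]; split=> //; exact: connect0.
exists Lo, B; split=> //.
- by move=> i /BK[]; rewrite set0U.
- move=> x y xK yK; apply: (sB x y x y set0 set0); rewrite ?(subsetP KW) //.
  + by rewrite xK.
  + by rewrite yK.
- move: bB; rewrite /= [\sum_(v in W) _]big1 ?addr0 // => x _.
  by rewrite /pcost; case: ifP; rewrite ?cost0.
Qed.
End Trees.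

Notation tlink := (link (@tsrc _) (@ttgt _)).

(** * One averaged step of the algorithm, and its iteration *)

Section Algorithm.
Import zify.zify algebra_tactics.lra algebra_tactics.ring.
Variables (A : realFieldType) (V : finType) (E : {set {set V}}).
Variable c : {set V} -> A.
Hypothesis c_ge0 : forall e, 0 <= c e.
Variables (T : {set V}) (H : pred {set V}) (x : {set V} -> A).
Hypothesis T_neq0 : T != set0.
Hypothesis H_sub : forall K, H K -> K \subset T.
Hypothesis H_neq0 : forall K, H K -> K != set0.
Hypothesis x_ge0 : forall K, H K -> 0 <= x K.
Hypothesis x_sub : forall S : {set V}, S \subset T -> S != set0 ->
  \sum_(K | H K && (K :&: S != set0)) x K * (#|K :&: S|%:R - 1) <= #|S|%:R - 1.
Hypothesis x_eq : \sum_(K | H K) x K * (#|K|%:R - 1) = #|T|%:R - 1.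

Local Notation tedge := (tedge V).
Local Notation tweight := (weight (tcost c)).
Local Notation tspans := (spans (@tsrc V) (@ttgt V)).
Local Notation adj := (adj E).
Local Notation cost := (cost c).

(** [Z] is the loss already bought; an edge of [L] may use it for free besides its own edge set. *)
Definition realizes (Z : {set {set V}}) (S : {set V}) (L : seq tedge) :=
  {in L, forall i, [/\ tsrc i \in S, ttgt i \in S &
    connect (adj (Z :|: i.2)) (tsrc i) (ttgt i)]}.

Definition state (Z : {set {set V}}) (L : seq tedge) := tspans L T /\ realizes Z T L.

Lemma realizes_mono (Z Z' : {set {set V}}) (S S' : {set V}) (L : seq tedge) :
  Z \subset Z' -> S \subset S' -> realizes Z S L -> realizes Z' S' L.
Proof.
move=> ZZ SS rL i /rL[si ti ci]; split; rewrite ?(subsetP SS) //.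
by apply: adj_mono ci; exact: setSU.
Qed.

(** The edge sets together with [Z] connect [T], a tree can be grown inside their union, and costs
    are subadditive. *)
Lemma state_tree (Z : {set {set V}}) (L : seq tedge) : state Z L ->
  exists W F, [/\ is_tree E W F, T \subset W & cost F <= tweight L + cost Z].
Proof.
case=> sL rL; pose U (M : seq tedge) := Z :|: \bigcup_(i <- M) i.2.
have costB (M : seq tedge) : cost (\bigcup_(i <- M) i.2) <= tweight M.
  elim: M => [|i M IH]; first by rewrite /weight !big_nil cost0.
  rewrite /weight !big_cons; apply: le_trans (costU c_ge0 _ _) _.
  by rewrite lerD2l.
have [r rT] := set0Pn _ T_neq0.
have : {in T, forall y, connect (adj (U L)) r y}.
  move=> y yT; apply: link_min (sL r y rT yT).
  - exact: connect0.
  - exact: adj_sym.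
  - exact: connect_trans.
  - move=> i iL; case: (rL i iL) => _ _; apply: adj_mono; apply: setUS.
    by rewrite (big_rem i) //= subsetUl.
case/grow=> W [F [gF FU TW]]; exists W, F; split=> //.
  exact: grown_is_tree gF.
apply: le_trans (cost_subset c_ge0 FU) _; apply: le_trans (costU c_ge0 _ _) _.
by rewrite addrC lerD2r.
Qed.

Variables (Lo : {set V} -> {set {set V}}) (B : {set V} -> seq tedge).
Hypothesis B_realizes : forall K, H K -> realizes (Lo K) K (B K).
Hypothesis B_spans : forall K, H K -> tspans (B K) K.
Variable p : A.
Hypothesis p_ge0 : 0 <= p.
Hypothesis p_le1 : p <= 1.
Hypothesis p_small : p * \sum_(K | H K) x K < 1.

(** [p * avgw] and [p * avgl] are the expected terminal weight and loss that one step adds. *)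
Definition avgw := \sum_(K | H K) x K * tweight (B K).
Definition avgl := \sum_(K | H K) x K * cost (Lo K).

(* The hyperedge [K] is drawn with probability [p * x K], and nothing is drawn
   with the remaining probability; some outcome is at most the expectation. *)
Lemma step (g : A) (Z : {set {set V}}) (L : seq tedge) : 0 <= g -> state Z L ->
  exists Z' L', [/\ state Z' L', (forall K, Lo K = set0) -> Z' = Z &
    g * tweight L' + cost Z' <=
    g * ((1 - p) * tweight L + p * avgw) + cost Z + p * avgl].
Proof.
move=> g0 [sL rL].
have tc0 i : 0 <= tcost c i by exact: cost_ge0.
have TL : {in L, forall i, (tsrc i \in T) && (ttgt i \in T)}.
  by move=> i /rL[-> ->].
have [L0 [M [[L0L ML] wL0 sL0 sM hb]]] :=
  bridge tc0 T_neq0 H_sub H_neq0 x_sub x_eq sL TL.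
pose RHS := g * ((1 - p) * tweight L + p * avgw) + cost Z + p * avgl.
have [h0|h0] := leP (g * tweight L0 + cost Z) RHS.
  by exists Z, L0; split=> //; split=> // i /L0L; exact: rL.
have [/existsP[K /andP[HK hK]]|] :=
    boolP [exists K, H K && (g * tweight (M K ++ B K) + cost (Z :|: Lo K) <= RHS)].
  exists (Z :|: Lo K), (M K ++ B K); split=> //; last by move=> ->; rewrite setU0.
  split; first by apply: sM; exact: B_spans.
  move=> i; rewrite mem_cat => /orP[/ML iL|iB].
    by apply: (realizes_mono _ (subxx _) rL iL); exact: subsetUl.
  apply: (realizes_mono _ _ (B_realizes HK) iB); [exact: subsetUr | exact: H_sub].
(* Now every outcome exceeds the bound on the expectation; averaging them leads to a
   contradiction. *)
rewrite negb_exists => /forallP hK.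
have {}hK K : H K -> RHS <= g * (tweight (M K) + tweight (B K)) + (cost Z + cost (Lo K)).
  move=> HK; have := hK K; rewrite HK /= -ltNge => /ltW/le_trans; apply.
  by apply: lerD; [rewrite /weight big_cat | exact: costU].
have hS : (\sum_(K | H K) x K) * RHS <=
    \sum_(K | H K) x K * (g * (tweight (M K) + tweight (B K)) + (cost Z + cost (Lo K))).
  rewrite mulr_suml; apply: ler_sum => K HK; apply: ler_wpM2l; [exact: x_ge0 | exact: hK].
have eS : \sum_(K | H K) x K * (g * (tweight (M K) + tweight (B K)) + (cost Z + cost (Lo K)))
  = (\sum_(K | H K) x K) * (g * tweight L0 + cost Z) + g * avgw + avgl
    - g * \sum_(K | H K) x K * (tweight L0 - tweight (M K)).
  move: (tweight L0) => w0.
  rewrite /avgw /avgl mulr_suml !mulr_sumr -!big_split /= -sumrN -big_split /=.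
  by apply: eq_bigr => K _; ring.
have ps := p_small; move: hS; rewrite eS; set s := \sum_(K | H K) x K in ps *.
set t := \sum_(K | H K) _ in hb *; move=> hS.
have h1 : p * (s * RHS) <= p * (s * (g * tweight L0 + cost Z) + g * avgw + avgl - g * t).
  exact: ler_wpM2l.
have h2 : p * g * tweight L0 <= p * g * t by apply: ler_wpM2l; rewrite ?mulr_ge0.
(* Drawing nothing has positive probability [1 - p * s], which makes the averaged inequality
   strict. *)
have h3 : (1 - p * s) * RHS < (1 - p * s) * (g * tweight L0 + cost Z).
  by rewrite ltr_pM2l // subr_gt0.
have h4 : g * (1 - p) * tweight L0 <= g * (1 - p) * tweight L.
  by apply: ler_wpM2l; rewrite // mulr_ge0 // subr_ge0.
have : RHS = g * ((1 - p) * tweight L + p * avgw) + cost Z + p * avgl by [].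
lra.
Qed.

(** The [n] steps to come scale the present terminal weight by [(1 - p) ^+ n]. The step before them
    is therefore chosen with the terminal weight discounted by this factor, the [g] of [step], and
    the loss counted in full. *)
Lemma iterate (n : nat) (Z : {set {set V}}) (L : seq tedge) : state Z L ->
  exists Z' L', [/\ state Z' L', (forall K, Lo K = set0) -> Z' = Z &
    tweight L' + cost Z' <= (1 - p) ^+ n * tweight L +
      (1 - (1 - p) ^+ n) * avgw + cost Z + n%:R * (p * avgl)].
Proof.
elim: n Z L => [|n IH] Z L sL.
  by exists Z, L; split=> //; rewrite expr0 mul1r subrr !mul0r !addr0.
have q0 : 0 <= (1 - p) ^+ n by rewrite exprn_ge0 // subr_ge0.
have [Z1 [L1 [s1 e1 h1]]] := step q0 sL.
have [Z2 [L2 [s2 e2 h2]]] := IH Z1 L1 s1.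
exists Z2, L2; split=> //; first by move=> h; rewrite e2 // e1.
by rewrite exprSr -natr1; lra.
Qed.
End Algorithm.

(** * The two phases of the algorithm, measured against the linear program *)

Section Gap.
Variables (A : realFieldType) (V : finType) (E : {set {set V}}).
Variable c : {set V} -> A.
Hypothesis c_ge0 : forall e, 0 <= c e.
Variables (T : {set V}) (H : pred {set V}) (x C : {set V} -> A).
Hypothesis T_neq0 : T != set0.
Hypothesis H_sub : forall K, H K -> K \subset T.
Hypothesis H_neq0 : forall K, H K -> K != set0.
Hypothesis x_ge0 : forall K, H K -> 0 <= x K.
Hypothesis x_sub : forall S : {set V}, S \subset T -> S != set0 ->
  \sum_(K | H K && (K :&: S != set0)) x K * (#|K :&: S|%:R - 1) <= #|S|%:R - 1.
Hypothesis x_eq : \sum_(K | H K) x K * (#|K|%:R - 1) = #|T|%:R - 1.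
Hypothesis C_tree : forall K, H K ->
  exists W F, [/\ is_tree E W F, K \subset W & cost c F = C K].
Hypothesis T_tree : exists W F, is_tree E W F /\ T \subset W.

Lemma components (b : bool) :
  exists (Lo : {set V} -> {set {set V}}) (B : {set V} -> seq (tedge V)),
  forall K, [/\ H K -> realizes E (Lo K) K (B K),
     H K -> spans (@tsrc V) (@ttgt V) (B K) K,
     ~~ b -> Lo K = set0 &
     H K -> if b
            then weight (tcost c) (B K) + cost c (Lo K) <= C K /\ 2 * cost c (Lo K) <= C K
            else weight (tcost c) (B K) <= 2 * C K].
Proof.
suff /fin_all_exists[f fP] : forall K : {set V}, exists y : {set {set V}} * seq (tedge V),
    [/\ H K -> realizes E y.1 K y.2,
     H K -> spans (@tsrc V) (@ttgt V) y.2 K,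
     ~~ b -> y.1 = set0 &
     H K -> if b then weight (tcost c) y.2 + cost c y.1 <= C K /\ 2 * cost c y.1 <= C K
            else weight (tcost c) y.2 <= 2 * C K].
  by exists (fun K => (f K).1), (fun K => (f K).2).
(* Outside [H] the default has empty loss, because the lossless clause ranges over every set. *)
move=> K; have [HK|] := boolP (H K); last by exists (set0, [::]).
have [W [F [tF KW <-]]] := C_tree HK.
have [Lo [B [? ? ? ?]]] := tree_terminals c_ge0 b tF KW (H_neq0 HK).
by exists (Lo, B).
Qed.

(* [l] is the fractional loss and [D] the cost of an arbitrary initial terminal tree;
   [m] steps without loss bring the cost down to about [2 * LP], after which [n]
   loss-contracting steps are made. *)
Lemma steiner_bound : let LP := \sum_(K | H K) C K * x K in
  exists D l : A, [/\ 0 <= D, 0 <= l, 2 * l <= LP & forall (p : A) (m n : nat),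
    0 <= p -> p <= 1 -> p * \sum_(K | H K) x K < 1 ->
    exists W F, [/\ is_tree E W F, T \subset W &
      cost c F <= (1 - p) ^+ n * ((1 - p) ^+ m * D + 2 * LP) +
                  (1 - (1 - p) ^+ n) * (LP - l) + n%:R * (p * l)]].
Proof.
move=> LP.
have [W0 [F0 [tF0 TW0]]] := T_tree.
have [r rT] := set0Pn _ T_neq0.
(* A crude start: every terminal is joined to [r] by an edge standing for the entire tree [F0]. The
   lossless steps damp its weight. *)
pose L0 := [seq (r, y, F0) : tedge V | y <- enum T].
have s0 : state E T set0 L0.
  split.
    move=> y z yT zT; have l w : w \in T -> connect (tlink L0) r w.
      by move=> wT; apply: (@link_in _ _ (@tsrc V) (@ttgt V) _ (r, w, F0));
         apply: map_f; rewrite mem_enum.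
    by apply: connect_trans (l z zT); rewrite link_sym l.
  move=> i /mapP[y]; rewrite mem_enum => yT ->; split=> //=; rewrite set0U.
  have gF := tree_grown tF0 (subsetP TW0 _ rT).
  exact: (grown_connect gF (subsetP TW0 _ yT)).
have [Lo1 [B1 P1]] := components false.
have [Lo2 [B2 P2]] := components true.
exists (weight (tcost c) L0), (avgl c H x Lo2); split.
- by apply: sumr_ge0 => i _; exact: cost_ge0.
- by apply: sumr_ge0 => K HK; rewrite mulr_ge0 ?x_ge0 ?cost_ge0.
- rewrite mulr_sumr; apply: ler_sum => K HK; rewrite mulrCA mulrC.
  by apply: ler_wpM2r; [exact: x_ge0 | case: (P2 K) => _ _ _ /(_ HK)[]].
move=> p m n p0 p1 ps.
have q0 k : 0 <= (1 - p) ^+ k by rewrite exprn_ge0 // subr_ge0.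
have q1 k : (1 - p) ^+ k <= 1 by rewrite exprn_ile1 // ?subr_ge0 // gerBl.
have R1 K : H K -> realizes E (Lo1 K) K (B1 K) by case: (P1 K).
have S1 K : H K -> spans (@tsrc V) (@ttgt V) (B1 K) K by case: (P1 K).
have R2 K : H K -> realizes E (Lo2 K) K (B2 K) by case: (P2 K).
have S2 K : H K -> spans (@tsrc V) (@ttgt V) (B2 K) K by case: (P2 K).
have L10 K : Lo1 K = set0 by case: (P1 K) => _ _ /(_ isT).
have [Z1 [L1 [s1 /(_ L10)Z1E h1]]] :=
  iterate c_ge0 T_neq0 H_sub H_neq0 x_ge0 x_sub x_eq R1 S1 p0 p1 ps m s0.
rewrite Z1E in s1 h1.
have [Z2 [L2 [s2 _ h2]]] :=
  iterate c_ge0 T_neq0 H_sub H_neq0 x_ge0 x_sub x_eq R2 S2 p0 p1 ps n s1.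
have [W [F [tF TW hF]]] := state_tree c_ge0 T_neq0 s2.
exists W, F; split=> //; apply: le_trans hF _; apply: le_trans h2 _.
have l0 : avgl c H x Lo1 = 0.
  by rewrite /avgl big1 // => K _; rewrite L10 cost0 mulr0.
have w1 : avgw c H x B1 <= 2 * LP.
  rewrite /avgw mulr_sumr; apply: ler_sum => K HK; rewrite mulrC mulrA.
  by apply: ler_wpM2r; [exact: x_ge0 | case: (P1 K) => _ _ _; exact].
have w2 : avgw c H x B2 <= LP - avgl c H x Lo2.
  rewrite lerBrDr -big_split /=; apply: ler_sum => K HK; rewrite -mulrDr mulrC.
  by apply: ler_wpM2r; [exact: x_ge0 | case: (P2 K) => _ _ _ /(_ HK)[]].
have LP0 : 0 <= LP.
  apply: sumr_ge0 => K HK; rewrite mulr_ge0 ?x_ge0 //.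
  by have [W1 [F1 [_ _ <-]]] := C_tree HK; exact: cost_ge0.
move: h1; rewrite cost0 l0 !mulr0 !addr0 => h1.
have {}h1 : weight (tcost c) L1 <= (1 - p) ^+ m * weight (tcost c) L0 + 2 * LP.
  apply: le_trans h1 _; rewrite lerD2l.
  have := ler_wpM2l (_ : 0 <= 1 - (1 - p) ^+ m) w1.
  rewrite subr_ge0 q1 => /(_ isT)/le_trans; apply.
  by rewrite ler_piMl ?mulr_ge0 // gerBl.
rewrite lerD2r; apply: lerD; apply: ler_wpM2l => //; by rewrite subr_ge0.
Qed.
End Gap.

(* The limit over the real numbers, and the theorem *)
From Stdlib Require Import Reals Lra.

Lemma ln3_ge1 : (1 <= ln 3)%R.
Proof.
rewrite -[X in (X <= _)%R]ln_exp; case: exp_le_3 => [lt3|->]; last exact: Rle_refl.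
by left; apply: ln_increasing => //; exact: exp_pos.
Qed.

Lemma exp_pow_le (p : R) (n : nat) : (p <= 1)%R -> ((1 - p) ^ n <= exp (- (INR n * p)))%R.
Proof.
move=> p1; elim: n => [|n IH]; first by rewrite /= Rmult_0_l Ropp_0 exp_0; exact: Rle_refl.
have -> : (- (INR n.+1 * p) = - p + - (INR n * p))%R by rewrite S_INR; ring.
rewrite exp_plus; apply: Rmult_le_compat => //; [lra | by apply: pow_le; lra |].
by have := exp_ineq1_le (- p); lra.
Qed.

(* [n] steps with [n * p = ln 3] shrink the initial tree by the factor 3. *)
Lemma gap_bound (l LP D s OPT : R) : (0 <= D)%R -> (0 <= l)%R -> (2 * l <= LP)%R ->
  (forall (p : R) (m n : nat), 0 <= p -> p <= 1 -> p * s < 1 ->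
    OPT <= (1 - p) ^ n * ((1 - p) ^ m * D + 2 * LP) + (1 - (1 - p) ^ n) * (LP - l)
           + INR n * (p * l))%R ->
  (OPT <= (1 + ln 3 / 2) * LP)%R.
Proof.
move=> D0 l0 lLP hO; have ln31 := ln3_ge1.
(* The factor [Rabs s + 1] makes [n] large enough for both [p < 1] and [p * s < 1]. *)
have [n hn] := INR_unbounded (ln 3 * (Rabs s + 1))%R.
have s0 := Rabs_pos s; have ss := Rle_abs s.
have n0 : (ln 3 < INR n)%R by apply: Rle_lt_trans hn; nra.
pose p := (ln 3 / INR n)%R.
have np : (INR n * p = ln 3)%R by rewrite /p; field; lra.
have p0 : (0 < p)%R by apply: Rdiv_lt_0_compat; lra.
have p1 : (p < 1)%R by nra.
have ps : (p * s < 1)%R.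
  apply: (Rmult_lt_reg_l (INR n)); first lra.
  by rewrite -Rmult_assoc np; nra.
have q3 : ((1 - p) ^ n <= / 3)%R.
  have := @exp_pow_le p n (Rlt_le _ _ p1).
  by rewrite np exp_Ropp exp_ln //; lra.
have q0 : (0 <= (1 - p) ^ n)%R by apply: pow_le; lra.
apply: le_epsilon => e e0.
(* With [p] fixed, [m0] is chosen so that the start contributes at most [e]; [D + 1] keeps the
   divisor positive. *)
have eD0 : (0 < e / (D + 1))%R by apply: Rdiv_lt_0_compat; lra.
have [|m0 hm] := @pow_lt_1_zero (1 - p)%R _ _ eD0; first by rewrite Rabs_pos_eq; lra.
have {hm} := hm m0 (le_n _); rewrite Rabs_pos_eq; last by apply: pow_le; lra.
have r0 : (0 <= (1 - p) ^ m0)%R by apply: pow_le; lra.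
move=> hm; have eD : ((1 - p) ^ m0 * D <= e)%R.
  have : ((1 - p) ^ m0 * (D + 1) <= e / (D + 1) * (D + 1))%R.
    by apply: Rmult_le_compat_r; lra.
  by rewrite /Rdiv Rmult_assoc Rinv_l; lra.
have := hO p m0 n (Rlt_le _ _ p0) (Rlt_le _ _ p1) ps.
rewrite -Rmult_assoc np; set q := ((1 - p) ^ n)%R in q0 q3 *.
set d := ((1 - p) ^ m0 * D)%R in eD *.
have d0 : (0 <= d)%R by apply: Rmult_le_pos.
have : (q * d <= d)%R by nra.
have : (q * (LP + l) <= / 3 * (LP + l))%R by apply: Rmult_le_compat_r; lra.
(* The coefficient of [l] is nonnegative because [ln 3] is at least 1, so [l] may be raised to
   [LP / 2]. *)
have : ((ln 3 - 2 / 3) * l <= (ln 3 - 2 / 3) * (LP / 2))%R by apply: Rmult_le_compat_l; lra.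
by lra.
Qed.

Theorem theorem1 (V : finType) (E : {set {set V}}) (T : {set V})
  (c : {set V} -> R)
  (hE : forall e, e \in E -> #|e| = 2%N)
  (hc : forall e, e \in E -> (0 <= c e)%R)
  (C : {set V} -> R)
  (hC : forall K, is_hyperedge E T K -> IsMin (full_cost_val E T c K) (C K))
  (OPT LPstar : R)
  (hOPT : IsMin (steiner_cost_val E T c) OPT)
  (hLP : IsMin (lp_val E T C) LPstar) :
  (OPT <= (1 + ln 3 / 2) * LPstar)%R.
Proof.
have [[x [[x0 [xs xe]] LPE]] _] := hLP.
have [[W0 [F0 [/andP[tF0 TW0] _]]] OPTle] := hOPT.
(* Off [E] the cost [c] may be negative; [c'] is nonnegative everywhere and agrees with [c] on trees
   of the graph. *)
pose c' e := if e \in E then c e else 0%R.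
have c'0 e : Order.le 0 (c' e).
  by rewrite /c'; case: ifP => [/hc/RleP//|_]; exact: lexx.
have costE W F : is_tree E W F -> cost c' F = tree_cost c F.
  case/and4P=> /subsetP FE _ _ _; apply: eq_bigr => e /FE eE.
  by rewrite /c' eE.
have Hsub K : is_hyperedge E T K -> K \subset T by case/and3P.
have H0 K : is_hyperedge E T K -> K != set0.
  by case/and3P=> _ K1 _; rewrite -card_gt0; apply: ltn_trans K1.
have T0 : T != set0.
  (* For empty [T] there are no hyperedges, and the equality constraint would read 0 = -1. *)
  apply: contraTneq isT => T0; move: xe; rewrite /lpsum big_pred0.
    by rewrite T0 cards0 /=; lra.
  move=> K; apply/negP => HK; have := Hsub K HK.
  by rewrite T0 subset0 (negPf (H0 K HK)).
have X0 K : is_hyperedge E T K -> Order.le 0 (x K) by move/x0/RleP.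
have Xs (S : {set V}) : S \subset T -> S != set0 -> Order.le
    (\sum_(K | is_hyperedge E T K && (K :&: S != set0)) x K * (#|K :&: S|%:R - 1))
    (#|S|%:R - 1 : R).
  move=> ST Sn; move/RleP: (xs S ST Sn); rewrite INRE.
  by congr (is_true (Order.le _ _)); apply: eq_bigr => K _; rewrite INRE.
have Xe : \sum_(K | is_hyperedge E T K) x K * (#|K|%:R - 1) = #|T|%:R - 1 :> R.
  by rewrite -INRE; apply: etrans xe; apply: eq_bigr => K _; rewrite INRE.
have Ct K : is_hyperedge E T K ->
    exists W F, [/\ is_tree E W F, K \subset W & cost c' F = C K].
  case/hC=> [[W [F [/and3P[tF /eqP KE _] ->]]] _]; exists W, F; split=> //.
    by rewrite -KE; apply/subsetP => z; rewrite inE => /andP[].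
  exact: costE tF.
have [|D [l [D0 l0 lLP bnd]]] := steiner_bound c'0 T0 Hsub H0 X0 Xs Xe Ct.
  by exists W0, F0.
rewrite LPE.
apply: (@gap_bound l _ D (\sum_(K | is_hyperedge E T K) x K)).
- exact/RleP.
- exact/RleP.
- exact/RleP.
move=> p m n p0 p1 ps.
have [|||W [F [tF TW hF]]] := bnd p m n; try exact/RleP; try exact/RltP.
apply: Rle_trans (OPTle (tree_cost c F) _) _.
  by exists W, F; rewrite /is_steiner_tree tF TW.
rewrite -(costE _ _ tF) !RpowE INRE; exact/RleP.
Qed.
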